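(* Let $d$, $m$, $n$ be integers such that $1 < d < m \le n$, and let $k$ be a positive integer. (i) If $m = dk$ and $n < m + k - 1$, then, with $\frac{p}{q} = \frac{1}{k}$ and $\frac{r}{s} = \frac{d}{m-1}$ (i.e. $p=1$, $q=k$, $r=d$, $s=m-1$), there is a continuous function $\lambda : [0,1] \to \mathbb{C}$ such that $\lambda(0) = e^{2\pi i p/q}$, $\lambda(1) = e^{2\pi i r/s}$, $P_\alpha(\lambda(\alpha)) = 0$ for all $\alpha \in [0,1]$, and \[ \min\left\{ \frac{p}{q}, \frac{r}{s} \right\} \le \frac{\operatorname{Arg} \lambda(\alpha)}{2\pi} \le \max\left\{ \frac{p}{q}, \frac{r}{s} \right\} \quad \text{for all } \alpha \in [0,1]. \] (ii) If $m - 1 = dk$ and $n < m + k - 1$, then, with $\frac{p}{q} = \frac{1}{k}$ and $\frac{r}{s} = \frac{d}{m}$ (i.e. $p=1$, $q=k$, $r=d$, $s=m$), there is a continuous function $\lambda : [0,1] \to \mathbb{C}$ such that $\lambda(0) = e^{2\pi i p/q}$, $\lambda(1) = e^{2\pi i r/s}$, $P_\alpha(\lambda(\alpha)) = 0$ for all $\alpha \in [0,1]$, and \[ \min\left\{ \frac{p}{q}, \frac{r}{s} \right\} \le \frac{\operatorname{Arg} \lambda(\alpha)}{2\pi} \le \max\left\{ \frac{p}{q}, \frac{r}{s} \right\} \quad \text{for all } \alpha \in [0,1]. \]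
   Context: For given $n$, $q$, $s$ (with $q \le s$) and $\alpha \in [0,1]$, the Ito polynomial is \[ P_\alpha(t) = t^s \left( t^q - (1-\alpha) \right)^{\lfloor n/q \rfloor} - \alpha^{\lfloor n/q \rfloor}\, t^{q \lfloor n/q \rfloor}. \] In each part of the claim, $P_\alpha$ is formed with the values of $q$ and $s$ specified in that part and the given $n$. For a nonzero complex number $z$, $\operatorname{Arg} z$ here denotes the argument of $z$ lying in $[0, 2\pi)$ (the bound on $\operatorname{Arg}\lambda(\alpha)$ includes the assertion that $\lambda(\alpha) \ne 0$). *)

(* Defs.v *)
From Stdlib Require Export Reals Lra Lia.
From Coquelicot Require Export Coquelicot.

Open Scope R_scope.

Definition Cexp (z : C) : C :=
  (exp (Re z) * cos (Im z), exp (Re z) * sin (Im z)).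

Lemma Cexp_Ci (x : R) : Cexp (Ci * RtoC x)%C = (cos x, sin x).
Proof.
  unfold Cexp, Cmult, Ci, RtoC, Re, Im; simpl.
  replace (0 * x - 1 * 0) with 0 by ring.
  replace (0 * 0 + 1 * x) with x by ring.
  rewrite exp_0, !Rmult_1_l; reflexivity.
Qed.

(* The branch of the argument with values in [0, 2 PI); the value at 0 is
   meaningless.  See [Carg_spec]. *)
Definition Carg (z : C) : R :=
  if Rle_dec 0 (Im z) then acos (Re z / Cmod z)
  else 2 * PI - acos (Re z / Cmod z).

Lemma Carg_spec (z : C) : z <> RtoC 0 ->
  0 <= Carg z < 2 * PI /\
  z = (RtoC (Cmod z) * Cexp (Ci * RtoC (Carg z)))%C.
Proof.
  intros Hz.
  assert (Hm : 0 < Cmod z) by (apply Cmod_gt_0; exact Hz).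
  pose proof PI_RGT_0 as HPI.
  set (c := Re z / Cmod z).
  assert (Hre : Re z = Cmod z * c) by (unfold c; field; lra).
  assert (Hc : -1 <= c <= 1).
  { pose proof (re_le_Cmod z) as H; rewrite Hre in H.
    apply Rabs_le_between in H. split; nra. }
  pose proof (acos_bound c) as Hb.
  assert (Him : (Im z)² = (Cmod z * sqrt (1 - c²))²).
  { rewrite Rsqr_mult, Rsqr_sqrt by (unfold Rsqr; nra).
    pose proof (Cmod2_alt z) as H. rewrite Hre in H.
    unfold Rsqr; nra. }
  pose proof (sqrt_pos (1 - c²)) as Hs.
  rewrite Cexp_Ci; unfold Carg; fold c.
  destruct (Rle_dec 0 (Im z)) as [Hi | Hi].
  - split; [lra |].
    rewrite cos_acos, sin_acos by exact Hc.
    apply Rsqr_inj in Him; [| exact Hi | nra].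
    destruct z as [x y]; unfold Cmult, RtoC, Re, Im in *; simpl in *.
    f_equal; nra.
  - assert (Hneg : Im z = - (Cmod z * sqrt (1 - c²))).
    { destruct (Rsqr_eq _ _ Him) as [H | H]; [nra | exact H]. }
    assert (H0 : acos c <> 0).
    { intros H0. pose proof (sin_acos c Hc) as H.
      rewrite H0, sin_0 in H. nra. }
    split; [lra |].
    replace (2 * PI - acos c) with (- acos c + 2 * INR 1 * PI)
      by (simpl; ring).
    rewrite cos_period, sin_period, cos_neg, sin_neg.
    rewrite cos_acos, sin_acos by exact Hc.
    destruct z as [x y]; unfold Cmult, RtoC, Re, Im in *; simpl in *.
    f_equal; nra.
Qed.

Definition Ito_poly (n q s : nat) (alpha : R) (t : C) : C :=
  (t ^ s * (t ^ q - (1 - RtoC alpha)) ^ (n / q)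
   - RtoC alpha ^ (n / q) * t ^ (q * (n / q)))%C.

(* [lambda] is a total function, but only its restriction to [0, 1] matters:
   [continuous_on] is continuity relative to the given domain. *)
Definition Ito_root_path (n p q r s : nat) (lambda : R -> C) : Prop :=
  continuous_on (fun alpha => 0 <= alpha <= 1) lambda /\
  lambda 0 = Cexp (2 * PI * Ci * (INR p / INR q))%C /\
  lambda 1 = Cexp (2 * PI * Ci * (INR r / INR s))%C /\
  (forall alpha : R, 0 <= alpha <= 1 ->
     Ito_poly n q s alpha (lambda alpha) = RtoC 0) /\
  (forall alpha : R, 0 <= alpha <= 1 ->
     lambda alpha <> RtoC 0 /\
     Rmin (INR p / INR q) (INR r / INR s) <= Carg (lambda alpha) / (2 * PI)
       <= Rmax (INR p / INR q) (INR r / INR s)).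

(* Main.v *)
(** In both cases [n / k = d], and off [t = 0] the Ito polynomial reduces to
    [(t^k - (1 - a))^d = a^d t] in (i) and to [t (t^k - (1 - a))^d = a^d] in
    (ii).  Substituting [t = u^d], it suffices to solve the trinomial
    [u^(d k) = a u + (1 - a)], respectively [u^(d k + 1) = (1 - a) u + a].
    Hence everything follows from one root path of [u^M = a u + (1 - a)] whose
    argument runs from [2 PI / M] to [2 PI / (M - 1)], traversed backwards
    in (ii).  For [u] of modulus [r] and argument [t], put [x = M t - 2 PI] and
    [y = t - x]; the equation becomes [r^(M-1) sin x = a sin t] and
    [r^M sin y = (1 - a) sin t].  Eliminating [r] leaves
    [(1 - a)^(M-1) sin^M x = a^M sin t sin^(M-1) y], which has exactly one
    solution [t] in the sector because the logarithm of
    [sin^M x / (sin t sin^(M-1) y)] has positive derivative.  Uniqueness makes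
    [t], and then [r], continuous in [a]. *)

Require Import Defs.
From Stdlib Require Import Classical ClassicalEpsilon.

(** * Polar coordinates and the argument *)

Definition polar (r t : R) : C := (r * cos t, r * sin t).

Lemma polar_pow (r t : R) (n : nat) :
  (polar r t ^ n)%C = polar (r ^ n) (INR n * t).
Proof.
  unfold polar. induction n as [|n IH].
  - simpl. rewrite Rmult_0_l, cos_0, sin_0. unfold RtoC. f_equal; ring.
  - rewrite Cpow_S, IH, S_INR.
    replace ((INR n + 1) * t) with (t + INR n * t) by ring.
    rewrite cos_plus, sin_plus. unfold Cmult; simpl. f_equal; ring.
Qed.

Lemma Cexp_polar (x : R) : Cexp (2 * PI * Ci * x)%C = polar 1 (2 * PI * x).
Proof.
  replace (2 * PI * Ci * x)%C with (Ci * RtoC (2 * PI * x))%C.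
  - rewrite Cexp_Ci. unfold polar. f_equal; ring.
  - rewrite !RtoC_mult. ring.
Qed.

(** [acos] only returns angles in [[0, PI]]: it recovers [t] in the closed upper half plane and the
    reflected angle [2 * PI - t] below it, which is what [Carg] corrects. *)
Lemma Carg_polar (r t : R) :
  0 < r -> 0 <= t < 2 * PI -> Carg (polar r t) = t.
Proof.
  intros Hr Ht. pose proof PI_RGT_0 as HPI.
  assert (Hm : Cmod (polar r t) = r).
  { unfold polar, Cmod; cbn [fst snd].
    replace ((r * cos t) ^ 2 + (r * sin t) ^ 2) with (r²).
    - apply sqrt_Rsqr; lra.
    - pose proof (sin2_cos2 t) as H. unfold Rsqr in *. nra. }
  unfold Carg. rewrite Hm. unfold polar, Re, Im; cbn [fst snd].
  replace (r * cos t / r) with (cos t) by (field; lra).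
  destruct (Rle_dec t PI) as [Hle | Hgt].
  - rewrite acos_cos by lra.
    destruct (Rle_dec 0 (r * sin t)) as [_ | H]; [reflexivity |].
    exfalso; apply H. apply Rmult_le_pos; [lra | apply sin_ge_0; lra].
  - destruct (Rle_dec 0 (r * sin t)) as [H | _].
    + assert (sin t < 0) by (apply sin_lt_0; lra). nra.
    + replace (cos t) with (cos (2 * PI - t)).
      * rewrite acos_cos by lra. ring.
      * replace (2 * PI - t) with (- t + 2 * INR 1 * PI) by (simpl; ring).
        rewrite cos_period. apply cos_neg.
Qed.

(** * Continuity relative to a domain, and continuous implicit functions *)

Lemma continuous_on_comp {T U V : UniformSpace} (D : T -> Prop) (E : U -> Prop)
    (f : T -> U) (g : U -> V) :
  (forall x, D x -> E (f x)) ->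
  continuous_on D f -> continuous_on E g ->
  continuous_on D (fun x => g (f x)).
Proof.
  intros HDE Hf Hg x Hx P HP.
  specialize (Hg (f x) (HDE x Hx) P HP).
  specialize (Hf x Hx _ Hg).
  unfold filtermap, within in *.
  revert Hf. apply filter_imp. intros y Hy HD. apply Hy; [exact HD | auto].
Qed.

Lemma continuous_on_pair {T U V : UniformSpace} (D : T -> Prop)
    (f : T -> U) (g : T -> V) :
  continuous_on D f -> continuous_on D g ->
  continuous_on D (fun x => (f x, g x)).
Proof.
  intros Hf Hg x Hx P [eps HP].
  pose proof (Hf x Hx _ (locally_ball (f x) eps)) as H1.
  pose proof (Hg x Hx _ (locally_ball (g x) eps)) as H2.
  unfold filtermap, within in *.
  generalize (filter_and _ _ H1 H2). apply filter_imp.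
  intros y [Ha Hb] HD. apply HP. split; auto.
Qed.

Lemma continuous_on_polar {T : UniformSpace} (D : T -> Prop) (r t : T -> R) :
  continuous_on D r -> continuous_on D t ->
  continuous_on D (fun x => polar (r x) (t x)).
Proof.
  intros Hr Ht.
  assert (Hc : forall z : R * R,
             continuous (fun z : R * R => polar (fst z) (snd z)) z).
  { intros z.
    assert (H1 : continuous (fun z : R * R => fst z * cos (snd z)) z).
    { apply (continuous_mult (K := R_AbsRing)); [apply continuous_fst |].
      apply (continuous_comp snd cos); [apply continuous_snd | apply continuous_cos]. }
    assert (H2 : continuous (fun z : R * R => fst z * sin (snd z)) z).
    { apply (continuous_mult (K := R_AbsRing)); [apply continuous_fst |].
      apply (continuous_comp snd sin); [apply continuous_snd | apply continuous_sin]. }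
    intros P [eps HP].
    specialize (H1 _ (locally_ball _ eps)). specialize (H2 _ (locally_ball _ eps)).
    unfold filtermap in *.
    generalize (filter_and _ _ H1 H2). apply filter_imp.
    intros y [Ha Hb]. apply HP. split; assumption. }
  apply (continuous_on_comp D (fun _ => True) (fun x => (r x, t x))
           (fun z : R * R => polar (fst z) (snd z))).
  - trivial.
  - apply continuous_on_pair; assumption.
  - apply continuous_on_forall. intros z _. apply Hc.
Qed.

Lemma ex_derive_continuity_pt (f : R -> R) (x : R) :
  ex_derive f x -> continuity_pt f x.
Proof.
  intros H. apply continuity_pt_filterlim.
  exact (ex_derive_continuous (V := R_NormedModule) f x H).
Qed.

(** The last hypothesis lets [F x p] cross zero only once, and upwards, as [x] grows; this asks less
    than monotonicity in [x]. The zero exists by the intermediate value theorem, and separate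
    continuity in each variable suffices for it to depend continuously on [p]. *)
Lemma upcrossing_implicit (A B : R) (D : R -> Prop) (F : R -> R -> R) :
  A <= B ->
  (forall p, D p -> F A p <= 0 <= F B p) ->
  (forall p, continuity (fun x => F x p)) ->
  (forall x p, continuous (F x) p) ->
  (forall p x y, D p -> A <= x -> x < y -> y <= B -> 0 <= F x p -> 0 < F y p) ->
  exists h : R -> R, continuous_on D h /\
    forall p, D p -> A <= h p <= B /\ F (h p) p = 0.
Proof.
  intros HAB Hsgn Hcx Hcp Hup.
  assert (Hex : forall p, exists x, D p -> A <= x <= B /\ F x p = 0).
  { intros p. destruct (classic (D p)) as [HD | HD].
    - destruct (IVT_gen (fun x => F x p) A B 0 (Hcx p)) as [x [Hx Hx0]].
      + specialize (Hsgn p HD). rewrite Rmin_left, Rmax_right by lra. exact Hsgn.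
      + rewrite Rmin_left, Rmax_right in Hx by lra. exists x. auto.
    (* Off [D] the value is arbitrary; 0 is a default. *)
    - exists 0. tauto. }
  pose (h := fun p => proj1_sig (constructive_indefinite_description _ (Hex p))).
  assert (Hh : forall p, D p -> A <= h p <= B /\ F (h p) p = 0)
    by (intros p; exact (proj2_sig (constructive_indefinite_description _ (Hex p)))).
  clearbody h.
  exists h. split; [| exact Hh].
  intros p HD. destruct (Hh p HD) as [Hb H0].
  apply filterlim_locally. intros eps. pose proof (cond_pos eps) as He.
  (* [F] is positive at the fixed abscissa [h p + eps], and stays so for parameters [q] near [p]. A
     zero [h q] at or beyond that abscissa would then contradict [Hup]. The lower bound is
     symmetric. *)
  assert (Hhi : within D (locally p) (fun q => h q < h p + eps)).
  { destruct (Rlt_dec B (h p + eps)) as [HB | HB].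
    - unfold within. apply filter_forall. intros q HDq. destruct (Hh q HDq). lra.
    - assert (Hpos : 0 < F (h p + eps) p).
      { apply (Hup p (h p)); try assumption; lra. }
      pose proof (Hcp (h p + eps) p _ (open_gt 0 _ Hpos)) as Hn.
      unfold filtermap in Hn. unfold within. revert Hn. apply filter_imp.
      intros q Hq HDq. destruct (Hh q HDq) as [Hbq H0q].
      destruct (Rtotal_order (h q) (h p + eps)) as [H | [H | H]];
        [exact H | rewrite <- H in Hq; lra |].
      pose proof (Hup q (h p + eps) (h q) HDq ltac:(lra) H ltac:(lra) ltac:(lra)).
      lra. }
  assert (Hlo : within D (locally p) (fun q => h p - eps < h q)).
  { destruct (Rlt_dec (h p - eps) A) as [HA | HA].
    - unfold within. apply filter_forall. intros q HDq. destruct (Hh q HDq). lra.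
    - assert (Hneg : F (h p - eps) p < 0).
      { apply Rnot_le_lt. intros Hn.
        pose proof (Hup p (h p - eps) (h p) HD ltac:(lra) ltac:(lra) ltac:(lra) Hn).
        lra. }
      pose proof (Hcp (h p - eps) p _ (open_lt 0 _ Hneg)) as Hn.
      unfold filtermap in Hn. unfold within. revert Hn. apply filter_imp.
      intros q Hq HDq. destruct (Hh q HDq) as [Hbq H0q].
      destruct (Rtotal_order (h q) (h p - eps)) as [H | [H | H]];
        [| rewrite <- H in Hq; lra | lra].
      pose proof (Hup q (h q) (h p - eps) HDq ltac:(lra) H ltac:(lra) ltac:(lra)).
      lra. }
  unfold within in *. generalize (filter_and _ _ Hhi Hlo).
  apply filter_imp. intros q [H1 H2] HDq. specialize (H1 HDq). specialize (H2 HDq).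
  change (Rabs (h q - h p) < eps). apply Rabs_def1; lra.
Qed.


(** * The angle: a single crossing in the sector *)

Lemma pow_lt_mono (n : nat) (x y : R) :
  (0 < n)%nat -> 0 <= x -> x < y -> x ^ n < y ^ n.
Proof.
  intros Hn Hx Hxy. destruct n as [|n]; [lia |]. simpl.
  pose proof (pow_incr x y n ltac:(lra)). pose proof (pow_lt y n ltac:(lra)).
  nra.
Qed.

(** With [M = p + 1], these are the angles at which both [x = M t - 2 PI] and [y = 2 PI - p t] are
    nonnegative; [x] vanishes at the left end and [y] at the right end. *)
Definition sector (p : nat) (t : R) : Prop :=
  2 * PI / INR (S p) <= t <= 2 * PI / INR p.

(** The inner angles are nonnegative and add up to [t], so neither exceeds [t]; and [3 <= p] gives
    [t <= 2 PI / 3]. All sines involved are therefore nonnegative. *)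
Lemma sector_angles (p : nat) (t : R) : (3 <= p)%nat -> sector p t ->
  0 < t < PI /\ 0 <= INR (S p) * t - 2 * PI <= t /\ 0 <= 2 * PI - INR p * t <= t.
Proof.
  intros Hp [Hl Hr]. pose proof PI_RGT_0 as HPI.
  pose proof (le_INR 3 p Hp) as H3. rewrite (S_INR p) in *. simpl in H3.
  assert (E1 : (INR p + 1) * (2 * PI / (INR p + 1)) = 2 * PI) by (field; lra).
  assert (E2 : INR p * (2 * PI / INR p) = 2 * PI) by (field; lra).
  repeat split; nra.
Qed.

Lemma sector_ends (p : nat) : (3 <= p)%nat ->
  2 * PI / INR (S p) < 2 * PI / INR p /\
  INR (S p) * (2 * PI / INR (S p)) = 2 * PI /\
  INR p * (2 * PI / INR p) = 2 * PI.
Proof.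
  intros Hp. pose proof PI_RGT_0 as HPI.
  pose proof (le_INR 3 p Hp) as H3. rewrite (S_INR p) in *. simpl in H3.
  repeat split; [| field; lra | field; lra].
  apply Rmult_lt_compat_l; [lra |]. apply Rinv_lt_contravar; nra.
Qed.

(* The derivative of this function is [M^2 c + p^2 e - cot (x + y)], where
   [M = p + 1], [x] and [y] are the two inner angles, whose sum is [t], and
   [c = cot x], [e = cot y].  As [cot (x + y) = (c e - 1) / (c + e)], it equals
   [((M c + p e)^2 + 1) / (c + e)]. *)
Lemma log_ratio_increasing (p : nat) (s t : R) : (3 <= p)%nat ->
  2 * PI / INR (S p) < s -> s < t -> t < 2 * PI / INR p ->
  let L u := INR (S p) * ln (sin (INR (S p) * u - 2 * PI)) - ln (sin u)
             - INR p * ln (sin (2 * PI - INR p * u)) in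
  L s < L t.
Proof.
  intros Hp Hs Hst Ht L.
  set (dL := fun u =>
    INR (S p) * (INR (S p) * cos (INR (S p) * u - 2 * PI)
                   / sin (INR (S p) * u - 2 * PI))
    - cos u / sin u
    + INR p * (INR p * cos (2 * PI - INR p * u) / sin (2 * PI - INR p * u))).
  destruct (sector_ends p Hp) as [_ [E1 E2]].
  assert (Hsin : forall u, 2 * PI / INR (S p) < u -> u < 2 * PI / INR p ->
     0 < sin u /\ 0 < sin (INR (S p) * u - 2 * PI)
     /\ 0 < sin (2 * PI - INR p * u)).
  { intros u Hu1 Hu2.
    destruct (sector_angles p u Hp) as [A [B C]]; [split; lra |].
    pose proof (le_INR 3 p Hp) as H3. simpl in H3.
    pose proof (S_INR p) as HS.
    repeat split; apply sin_gt_0; nra. }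
  apply (incr_function L (2 * PI / INR (S p)) (2 * PI / INR p) dL);
    try assumption; simpl; intros u Hu1 Hu2;
    destruct (Hsin u Hu1 Hu2) as [A [B C]].
  - unfold L, dL. clear - A B C. revert B C. generalize (INR (S p)) (INR p).
    intros m q B C. auto_derive.
    + repeat split; assumption.
    + unfold Rminus in *. field. lra.
  - unfold dL.
    set (x := INR (S p) * u - 2 * PI) in *. set (y := 2 * PI - INR p * u) in *.
    assert (Hu : u = x + y) by (unfold x, y; rewrite S_INR; ring).
    rewrite Hu in A |- *. rewrite sin_plus in A |- *. rewrite cos_plus.
    pose proof (S_INR p) as HS. rewrite HS.
    set (a := sin x) in *. set (b := cos x) in *.
    set (c := sin y) in *. set (e := cos y) in *. set (q := INR p) in *.
    replace ((q + 1) * ((q + 1) * b / a) - (b * e - a * c) / (a * e + b * c)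
             + q * (q * e / c))
      with ((((q + 1) * b * c + q * e * a) ^ 2 + (a * c) ^ 2)
              / (a * c * (a * e + b * c))) by (field; lra).
    apply Rlt_gt, Rdiv_lt_0_compat.
    + apply Rplus_le_lt_0_compat; [apply pow2_ge_0 |].
      apply pow_lt, Rmult_lt_0_compat; assumption.
    + apply Rmult_lt_0_compat; [apply Rmult_lt_0_compat |]; lra.
Qed.

(** The equation left after eliminating the modulus, kept free of quotients and logarithms so that
    it is continuous up to the ends of the sector and of [[0, 1]]. *)
Definition crossing (p : nat) (t a : R) : R :=
  (1 - a) ^ p * sin (INR (S p) * t - 2 * PI) ^ S p
  - a ^ S p * (sin t * sin (2 * PI - INR p * t) ^ p).

(** In the interior this is [log_ratio_increasing]. The boundary values of [a], [s] and [t], where a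
    logarithm is undefined, are settled first: there one of the two terms of [crossing] vanishes and
    the sign is explicit. *)
Lemma crossing_up (p : nat) (a s t : R) : (3 <= p)%nat -> 0 <= a <= 1 ->
  2 * PI / INR (S p) <= s -> s < t -> t <= 2 * PI / INR p ->
  0 <= crossing p s a -> 0 < crossing p t a.
Proof.
  intros Hp Ha Hs Hst Ht Hc.
  destruct (sector_ends p Hp) as [_ [E1 E2]].
  destruct (sector_angles p s Hp) as [As [Bs Cs]]; [split; lra |].
  destruct (sector_angles p t Hp) as [At [Bt Ct]]; [split; lra |].
  pose proof (le_INR 3 p Hp) as H3. simpl in H3.
  pose proof (S_INR p) as HS.
  unfold crossing in *.
  assert (Ss : 0 < sin s) by (apply sin_gt_0; lra).
  assert (St : 0 < sin t) by (apply sin_gt_0; lra).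
  assert (Sy : 0 < sin (2 * PI - INR p * s)) by (apply sin_gt_0; nra).
  assert (Sx : 0 < sin (INR (S p) * t - 2 * PI)) by (apply sin_gt_0; nra).
  assert (Ha1 : a < 1).
  { destruct (Rle_lt_or_eq_dec a 1) as [H | H]; [lra | exact H | exfalso].
    rewrite H, Rminus_diag in Hc. rewrite pow_i, pow1 in Hc by lia.
    pose proof (pow_lt _ p Sy). nra. }
  destruct (Rle_lt_or_eq_dec 0 a) as [Ha0 | Ha0]; [lra | |].
  2:{ rewrite <- Ha0, (pow_i (S p)), Rminus_0_r, pow1 by lia.
      pose proof (pow_lt _ (S p) Sx). lra. }
  pose proof (pow_lt (1 - a) p ltac:(lra)) as Pa1.
  pose proof (pow_lt a (S p) Ha0) as Pa0.
  assert (Pr : forall x y, 0 < x -> 0 < y -> 0 < a ^ S p * (x * y ^ p)).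
  { intros x y Hx Hy. pose proof (pow_lt y p Hy) as Py.
    apply Rmult_lt_0_compat; [| apply Rmult_lt_0_compat]; assumption. }
  destruct (Rle_lt_or_eq_dec _ _ Hs) as [Hs' | Hs'].
  2:{ exfalso. replace (INR (S p) * s - 2 * PI) with 0 in Hc by (rewrite <- Hs'; lra).
      rewrite sin_0, pow_i in Hc by lia.
      pose proof (Pr _ _ Ss Sy). lra. }
  destruct (Rle_lt_or_eq_dec _ _ Ht) as [Ht' | Ht'].
  2:{ replace (2 * PI - INR p * t) with 0 by (rewrite Ht'; lra).
      rewrite sin_0, pow_i, !Rmult_0_r, Rminus_0_r by lia.
      apply Rmult_lt_0_compat; [assumption | apply pow_lt; assumption]. }
  assert (Sx' : 0 < sin (INR (S p) * s - 2 * PI)) by (apply sin_gt_0; nra).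
  assert (Sy' : 0 < sin (2 * PI - INR p * t)) by (apply sin_gt_0; nra).
  pose proof (log_ratio_increasing p s t Hp Hs' Hst Ht') as HL. cbv zeta in HL.
  assert (El : forall x, 0 < x ->
    ln ((1 - a) ^ p * x ^ S p) = INR p * ln (1 - a) + INR (S p) * ln x).
  { intros x Hx. rewrite ln_mult, !ln_pow by (try apply pow_lt; lra). reflexivity. }
  assert (Er : forall x y, 0 < x -> 0 < y ->
    ln (a ^ S p * (x * y ^ p)) = INR (S p) * ln a + (ln x + INR p * ln y)).
  { intros x y Hx Hy. pose proof (pow_lt y p Hy).
    rewrite (ln_mult (a ^ S p)), (ln_mult x), !ln_pow
      by first [lra | apply Rmult_lt_0_compat; lra].
    reflexivity. }
  (* The logarithms of the two terms are compared. The contributions of [a] and [1 - a] are the same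
     at [s] and at [t], so [HL] carries the inequality from [s] to [t]. *)
  apply Rlt_0_minus, ln_lt_inv.
  - apply Pr; assumption.
  - apply Rmult_lt_0_compat; [assumption | apply pow_lt; assumption].
  - rewrite El, Er by assumption.
    assert (H : ln (a ^ S p * (sin s * sin (2 * PI - INR p * s) ^ p))
             <= ln ((1 - a) ^ p * sin (INR (S p) * s - 2 * PI) ^ S p)).
    { apply ln_le; [apply Pr; assumption | lra]. }
    rewrite El, Er in H by assumption. lra.
Qed.

(** * The modulus as a function of the angle *)

(** Adding the two sine equations eliminates [a] and avoids dividing by a sine that vanishes at an
    end of the sector. The left side increases strictly with the modulus, is 0 at 0, and at 1 is
    [sin x + sin y >= sin (x + y) = sin t]. *)
Lemma trinomial_radius (p : nat) : (3 <= p)%nat ->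
  exists rho : R -> R, continuous_on (sector p) rho /\
    forall t, sector p t -> 0 < rho t <= 1 /\
      rho t ^ p * sin (INR (S p) * t - 2 * PI)
      + rho t ^ S p * sin (2 * PI - INR p * t) = sin t.
Proof.
  intros Hp.
  assert (Hpos : forall t, sector p t -> 0 < sin t
    /\ 0 <= sin (INR (S p) * t - 2 * PI) /\ 0 <= sin (2 * PI - INR p * t)
    /\ sin t <= sin (INR (S p) * t - 2 * PI) + sin (2 * PI - INR p * t)).
  { intros t Ht. destruct (sector_angles p t Hp Ht) as [A [B C]].
    pose proof (S_INR p) as HS.
    assert (Hx : 0 <= sin (INR (S p) * t - 2 * PI)) by (apply sin_ge_0; lra).
    assert (Hy : 0 <= sin (2 * PI - INR p * t)) by (apply sin_ge_0; lra).
    repeat split; try assumption; [apply sin_gt_0; lra |].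
    replace (sin t) with
      (sin ((INR (S p) * t - 2 * PI) + (2 * PI - INR p * t)))
      by (f_equal; rewrite HS; ring).
    rewrite sin_plus.
    pose proof (COS_bound (INR (S p) * t - 2 * PI)).
    pose proof (COS_bound (2 * PI - INR p * t)). nra. }
  destruct (upcrossing_implicit 0 1 (sector p) (fun r t =>
      r ^ p * sin (INR (S p) * t - 2 * PI)
      + r ^ S p * sin (2 * PI - INR p * t) - sin t)) as [rho [Hc Hr]].
  - lra.
  - intros t Ht. destruct (Hpos t Ht) as [A [B [C E]]].
    rewrite !pow_i, !pow1 by lia. lra.
  - intros t r. refine (ex_derive_continuity_pt _ _ _).
    auto_derive. trivial.
  - intros r t. apply (ex_derive_continuous (V := R_NormedModule)). auto_derive. trivial.
  - intros t r r' Ht H0 Hlt H1 HF. destruct (Hpos t Ht) as [A [B [C E]]].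
    pose proof (pow_lt_mono p r r' ltac:(lia) H0 Hlt).
    pose proof (pow_lt_mono (S p) r r' ltac:(lia) H0 Hlt).
    set (x := sin (INR (S p) * t - 2 * PI)) in *.
    set (y := sin (2 * PI - INR p * t)) in *.
    set (u := r ^ p) in *. set (u' := r' ^ p) in *.
    set (v := r ^ S p) in *. set (v' := r' ^ S p) in *.
    (* Strictness needs one positive coefficient: by [E] the two sines add up to at least
       [sin t > 0]. *)
    destruct (Rle_lt_or_eq_dec 0 x B); nra.
  - exists rho. split; [exact Hc |]. intros t Ht.
    destruct (Hr t Ht) as [[Hl Hu] H0]. destruct (Hpos t Ht) as [A _].
    split; [split; [| exact Hu] | lra].
    destruct Hl as [Hl | Hl]; [exact Hl | exfalso].
    rewrite <- Hl, !pow_i in H0 by lia. lra.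
Qed.

(* With [A := r^p sin x / sin t], the radial equation says
   [1 - A = r^(p+1) sin y / sin t], which makes [A] a zero of [crossing p t];
   as [crossing p t] is strictly decreasing, [A = a]. *)
Lemma crossing_zero_radius (p : nat) (r t a : R) : (3 <= p)%nat ->
  sector p t -> 0 <= a <= 1 -> 0 < r -> crossing p t a = 0 ->
  r ^ p * sin (INR (S p) * t - 2 * PI)
  + r ^ S p * sin (2 * PI - INR p * t) = sin t ->
  r ^ p * sin (INR (S p) * t - 2 * PI) = a * sin t
  /\ r ^ S p * sin (2 * PI - INR p * t) = (1 - a) * sin t.
Proof.
  intros Hp Ht Ha Hr HK HE.
  destruct (sector_angles p t Hp Ht) as [At [Bx By]].
  pose proof (S_INR p) as HS.
  assert (St : 0 < sin t) by (apply sin_gt_0; lra).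
  assert (Hx : 0 <= sin (INR (S p) * t - 2 * PI)) by (apply sin_ge_0; lra).
  assert (Hy : 0 <= sin (2 * PI - INR p * t)) by (apply sin_ge_0; lra).
  unfold crossing in HK.
  set (x := sin (INR (S p) * t - 2 * PI)) in *.
  set (y := sin (2 * PI - INR p * t)) in *.
  set (w := sin t) in *.
  pose proof (pow_lt r p Hr) as Rp. pose proof (pow_lt r (S p) Hr) as RM.
  set (A := r ^ p * x / w).
  assert (EA : r ^ p * x = A * w) by (unfold A; field; lra).
  assert (EB : r ^ S p * y = (1 - A) * w) by lra.
  assert (A0 : 0 <= A) by (apply Rdiv_le_0_compat; [apply Rmult_le_pos |]; lra).
  assert (A1 : 0 <= 1 - A) by (apply (Rmult_le_reg_r w); nra).
  (* After scaling by [w^p (r^p)^(p+1)], the substitutions [EA] and [EB] turn both terms into the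
     same product. *)
  assert (HA : (1 - A) ^ p * x ^ S p - A ^ S p * (w * y ^ p) = 0).
  { assert (Hw : w ^ p * (r ^ p) ^ S p <> 0).
    { apply Rmult_integral_contrapositive; split; apply pow_nonzero; lra. }
    apply (Rmult_eq_reg_l (w ^ p * (r ^ p) ^ S p)); [| exact Hw].
    rewrite Rmult_0_r.
    replace (w ^ p * (r ^ p) ^ S p * ((1 - A) ^ p * x ^ S p - A ^ S p * (w * y ^ p)))
      with (((1 - A) * w) ^ p * (r ^ p * x) ^ S p
            - A ^ S p * w ^ S p * ((r ^ p) ^ S p * y ^ p))
      by (rewrite !Rpow_mult_distr; simpl; ring).
    rewrite EA, <- EB, !Rpow_mult_distr, <- !pow_mult, (Nat.mul_comm (S p) p). ring. }
  assert (EAa : A = a).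
  { assert (Hmono : forall b c, 0 <= b -> b < c -> c <= 1 ->
      (1 - c) ^ p * x ^ S p - c ^ S p * (w * y ^ p)
      < (1 - b) ^ p * x ^ S p - b ^ S p * (w * y ^ p)).
    { intros b c Hb Hbc Hc.
      pose proof (pow_lt_mono p (1 - c) (1 - b) ltac:(lia) ltac:(lra) ltac:(lra)).
      pose proof (pow_lt_mono (S p) b c ltac:(lia) ltac:(lra) ltac:(lra)).
      pose proof (pow_le x (S p) Hx). pose proof (pow_le y p Hy).
      destruct (Rle_lt_or_eq_dec 0 x Hx) as [Hx' | Hx'].
      - pose proof (pow_lt x (S p) Hx').
        assert (0 <= w * y ^ p) by nra.
        set (u := x ^ S p) in *. set (v := w * y ^ p) in *. nra.
      - assert (Hy' : 0 < y) by (rewrite <- Hx' in HE; nra).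
        pose proof (pow_lt y p Hy').
        assert (0 < w * y ^ p) by nra.
        set (u := x ^ S p) in *. set (v := w * y ^ p) in *. nra. }
    destruct (Rtotal_order A a) as [H | [H | H]]; [| exact H |].
    - pose proof (Hmono A a A0 H (proj2 Ha)). lra.
    - pose proof (Hmono a A (proj1 Ha) H ltac:(lra)). lra. }
  rewrite <- EAa. split; assumption.
Qed.

(** * The root path of the trinomial *)

Lemma trinomial_root_path (p : nat) : (3 <= p)%nat ->
  exists r t : R -> R,
    continuous_on (fun a => 0 <= a <= 1) r /\
    continuous_on (fun a => 0 <= a <= 1) t /\
    r 0 = 1 /\ t 0 = 2 * PI / INR (S p) /\
    r 1 = 1 /\ t 1 = 2 * PI / INR p /\
    forall a, 0 <= a <= 1 -> 0 < r a /\ sector p (t a) /\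
      (polar (r a) (t a) ^ S p = a * polar (r a) (t a) + (1 - a))%C.
Proof.
  intros Hp. destruct (sector_ends p Hp) as [Hlt [E1 E2]].
  pose proof (S_INR p) as HS.
  pose proof (le_INR 3 p Hp) as H3. simpl in H3.
  destruct (upcrossing_implicit (2 * PI / INR (S p)) (2 * PI / INR p)
      (fun a => 0 <= a <= 1) (crossing p)) as [t [Hct Ht]].
  - lra.
  - intros a Ha.
    destruct (sector_angles p (2 * PI / INR (S p)) Hp) as [As [Bs Cs]]; [split; lra |].
    destruct (sector_angles p (2 * PI / INR p) Hp) as [At [Bt Ct]]; [split; lra |].
    unfold crossing. rewrite E1, E2, Rminus_diag, sin_0, !pow_i, !Rmult_0_r by lia.
    split.
    + assert (0 <= a ^ S p * (sin (2 * PI / INR (S p)) *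
         sin (2 * PI - INR p * (2 * PI / INR (S p))) ^ p)); [| lra].
      apply Rmult_le_pos; [apply pow_le; lra |].
      apply Rmult_le_pos; [| apply pow_le]; apply sin_ge_0; lra.
    + rewrite Rminus_0_r. apply Rmult_le_pos; apply pow_le; [lra |].
      apply sin_ge_0; lra.
  - intros a t. refine (ex_derive_continuity_pt _ _ _).
    unfold crossing. auto_derive. trivial.
  - intros t a. apply (ex_derive_continuous (V := R_NormedModule)).
    unfold crossing. auto_derive. trivial.
  - intros a s t Ha Hs Hst Htt. apply crossing_up; assumption.
  - destruct (trinomial_radius p Hp) as [rho [Hcr Hr]].
    assert (Hsec : forall a, 0 <= a <= 1 -> sector p (t a)) by (intros a Ha; apply Ht, Ha).
    assert (Hmain : forall a, 0 <= a <= 1 ->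
      rho (t a) ^ p * sin (INR (S p) * t a - 2 * PI) = a * sin (t a)
      /\ rho (t a) ^ S p * sin (2 * PI - INR p * t a) = (1 - a) * sin (t a)).
    { intros a Ha. destruct (Ht a Ha) as [_ HK].
      destruct (Hr (t a) (Hsec a Ha)) as [[Hr0 _] HE].
      apply crossing_zero_radius; auto. }
    assert (Hroot1 : forall r n, 0 < r -> (0 < n)%nat -> r <= 1 -> r ^ n = 1 -> r = 1).
    { intros r n H0 Hn H1 Hpow.
      destruct (Rle_lt_or_eq_dec r 1 H1) as [H | H]; [exfalso | exact H].
      apply (pow_lt_mono n) in H; [rewrite pow1 in H; lra | exact Hn | lra]. }
    (* At [a = 0] the first equation gives [sin x = 0]; as [0 <= x <= t < PI], this forces [x = 0].
       Likewise [a = 1] forces [y = 0]. *)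
    assert (Ht0 : t 0 = 2 * PI / INR (S p)).
    { destruct (Hmain 0 ltac:(lra)) as [Hx _].
      destruct (sector_angles p _ Hp (Hsec 0 ltac:(lra))) as [At [Bt Ct]].
      destruct (Hr _ (Hsec 0 ltac:(lra))) as [[Hr0 _] _].
      destruct (Rle_lt_or_eq_dec _ _ (proj1 Bt)) as [H | H].
      - assert (Hs : 0 < sin (INR (S p) * t 0 - 2 * PI)) by (apply sin_gt_0; lra).
        pose proof (pow_lt _ p Hr0). nra.
      - apply (Rmult_eq_reg_l (INR (S p))); lra. }
    assert (Ht1 : t 1 = 2 * PI / INR p).
    { destruct (Hmain 1 ltac:(lra)) as [_ Hy].
      destruct (sector_angles p _ Hp (Hsec 1 ltac:(lra))) as [At [Bt Ct]].
      destruct (Hr _ (Hsec 1 ltac:(lra))) as [[Hr0 _] _].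
      destruct (Rle_lt_or_eq_dec _ _ (proj1 Ct)) as [H | H].
      - assert (Hs : 0 < sin (2 * PI - INR p * t 1)) by (apply sin_gt_0; nra).
        pose proof (pow_lt _ (S p) Hr0). nra.
      - apply (Rmult_eq_reg_l (INR p)); lra. }
    exists (fun a => rho (t a)), t.
    split; [apply (continuous_on_comp _ (sector p)); assumption |].
    split; [exact Hct |].
    split.
    { destruct (Hmain 0 ltac:(lra)) as [_ Hy].
      destruct (sector_angles p _ Hp (Hsec 0 ltac:(lra))) as [At _].
      destruct (Hr _ (Hsec 0 ltac:(lra))) as [Hr0 _].
      apply (Hroot1 _ (S p)); try lia; try apply Hr0.
      assert (St : 0 < sin (t 0)) by (apply sin_gt_0; lra).
      apply (Rmult_eq_reg_r (sin (t 0))); [| lra].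
      (* Here [x = 0], so [y = t] and the second equation reduces to modulus to the power [p + 1]
         equal to 1. *)
      replace (2 * PI - INR p * t 0) with (t 0) in Hy by (rewrite Ht0 at 2; rewrite HS in *; lra).
      lra. }
    split; [exact Ht0 |].
    split.
    { destruct (Hmain 1 ltac:(lra)) as [Hx _].
      destruct (sector_angles p _ Hp (Hsec 1 ltac:(lra))) as [At _].
      destruct (Hr _ (Hsec 1 ltac:(lra))) as [Hr0 _].
      apply (Hroot1 _ p); try lia; try apply Hr0.
      assert (St : 0 < sin (t 1)) by (apply sin_gt_0; lra).
      apply (Rmult_eq_reg_r (sin (t 1))); [| lra].
      replace (INR (S p) * t 1 - 2 * PI) with (t 1) in Hx by (rewrite HS, Ht1 in *; lra).
      lra. }
    split; [exact Ht1 |].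
    intros a Ha. destruct (Hmain a Ha) as [Hx Hy].
    destruct (Hr _ (Hsec a Ha)) as [Hr0 _].
    destruct (sector_angles p _ Hp (Hsec a Ha)) as [At _].
    split; [apply Hr0 |]. split; [apply Hsec, Ha |].
    rewrite polar_pow. unfold Cminus, polar, Cplus, Cmult, Copp, RtoC. cbn [fst snd].
    assert (St : 0 < sin (t a)) by (apply sin_gt_0; lra).
    set (x := INR (S p) * t a - 2 * PI) in *.
    replace (INR (S p) * t a) with (x + 2 * INR 1 * PI) by (unfold x; simpl INR at 2; ring).
    rewrite cos_period, sin_period.
    replace (2 * PI - INR p * t a) with (t a - x) in Hy by (unfold x; rewrite HS; ring).
    rewrite sin_minus in Hy.
    assert (Hx' : rho (t a) ^ S p * sin x = rho (t a) * (a * sin (t a)))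
      by (rewrite <- Hx; simpl; ring).
    (* The imaginary part is the first equation times the modulus. The real part is multiplied by
       [sin t], and [cos x sin t] is rewritten as [sin (t - x) + sin x cos t], so that both
       equations apply. *)
    f_equal; [| rewrite Hx'; ring].
    apply (Rmult_eq_reg_r (sin (t a))); [| lra].
    replace (rho (t a) ^ S p * cos x * sin (t a))
      with ((1 - a) * sin (t a) + rho (t a) ^ S p * sin x * cos (t a))
      by (rewrite <- Hy; ring).
    rewrite Hx'. ring.
Qed.

(** * From the trinomial to the Ito polynomial *)

Lemma polar_neq_0 (r t : R) : 0 < r -> polar r t <> RtoC 0.
Proof.
  intros Hr H. unfold polar, RtoC in H. injection H as H1 H2.
  pose proof (sin2_cos2 t) as H. unfold Rsqr in H.
  apply Rmult_integral in H1. apply Rmult_integral in H2.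
  destruct H1 as [H1 | H1]; [lra |]. destruct H2 as [H2 | H2]; [lra |].
  rewrite H1, H2 in H. lra.
Qed.

(** The path is the [d]-th power of a polar path. The bounds on the end fractions keep [d t] in
    [[0, 2 PI)], so [Carg] returns it without wrapping; minimum and maximum allow the angle to run
    in either direction. *)
Lemma Ito_root_path_polar (n q r s d : nat) (rho t : R -> R) :
  continuous_on (fun a => 0 <= a <= 1) rho ->
  continuous_on (fun a => 0 <= a <= 1) t ->
  0 < INR q -> 0 < INR s ->
  rho 0 = 1 -> rho 1 = 1 ->
  INR d * t 0 = 2 * PI * (1 / INR q) ->
  INR d * t 1 = 2 * PI * (INR r / INR s) ->
  Rmax (1 / INR q) (INR r / INR s) < 1 ->
  0 <= Rmin (1 / INR q) (INR r / INR s) ->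
  (forall a, 0 <= a <= 1 -> 0 < rho a /\
     Rmin (t 0) (t 1) <= t a <= Rmax (t 0) (t 1) /\
     Ito_poly n q s a (polar (rho a) (t a) ^ d)%C = RtoC 0) ->
  exists lambda : R -> C, Ito_root_path n 1 q r s lambda.
Proof.
  intros Hr Ht Hq Hs Hr0 Hr1 H0 H1 Hmax Hmin Hroot.
  pose proof PI_RGT_0 as HPI. pose proof (pos_INR d) as Hd.
  exists (fun a => polar (rho a) (t a) ^ d)%C.
  split.
  { apply (continuous_on_ext _ (fun a => polar (rho a ^ d) (INR d * t a))).
    - intros a _. symmetry. apply polar_pow.
    - apply continuous_on_polar.
      + apply (continuous_on_comp _ (fun _ => True) rho (fun x => x ^ d));
          [trivial | exact Hr |].
        apply continuous_on_forall. intros x _.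
        apply (ex_derive_continuous (V := R_NormedModule)). auto_derive. trivial.
      + apply (continuous_on_comp _ (fun _ => True) t (fun x => INR d * x));
          [trivial | exact Ht |].
        apply continuous_on_forall. intros x _.
        apply (ex_derive_continuous (V := R_NormedModule)). auto_derive. trivial. }
  split.
  { rewrite polar_pow, Hr0, pow1, H0, <- RtoC_div, Cexp_polar by lra. reflexivity. }
  split.
  { rewrite polar_pow, Hr1, pow1, H1, <- RtoC_div, Cexp_polar by lra. reflexivity. }
  split.
  { intros a Ha. apply Hroot, Ha. }
  intros a Ha. destruct (Hroot a Ha) as [Hpos [Hb _]].
  rewrite polar_pow. pose proof (pow_lt _ d Hpos) as Hpd.
  split; [apply polar_neq_0, Hpd |].
  change (INR 1) with 1.
  assert (Hlo : 2 * PI * Rmin (1 / INR q) (INR r / INR s) <= INR d * t a).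
  { pose proof (Rmin_l (1 / INR q) (INR r / INR s)).
    pose proof (Rmin_r (1 / INR q) (INR r / INR s)).
    apply (Rle_trans _ (INR d * Rmin (t 0) (t 1)));
      [| apply Rmult_le_compat_l; lra].
    destruct (Rmin_case_strong (t 0) (t 1) (fun x => x = t 0 \/ x = t 1))
      as [-> | ->]; auto; [rewrite H0 | rewrite H1]; apply Rmult_le_compat_l; lra. }
  assert (Hhi : INR d * t a <= 2 * PI * Rmax (1 / INR q) (INR r / INR s)).
  { pose proof (Rmax_l (1 / INR q) (INR r / INR s)).
    pose proof (Rmax_r (1 / INR q) (INR r / INR s)).
    apply (Rle_trans _ (INR d * Rmax (t 0) (t 1)));
      [apply Rmult_le_compat_l; lra |].
    destruct (Rmax_case_strong (t 0) (t 1) (fun x => x = t 0 \/ x = t 1))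
      as [-> | ->]; auto; [rewrite H0 | rewrite H1]; apply Rmult_le_compat_l; lra. }
  rewrite Carg_polar; [| exact Hpd | split; nra].
  split; apply (Rmult_le_reg_l (2 * PI)); try lra;
    replace (2 * PI * (INR d * t a / (2 * PI))) with (INR d * t a)
      by (field; lra); assumption.
Qed.

Theorem theorem5p2 :
  forall d m n k : nat,
    (1 < d)%nat -> (d < m)%nat -> (m <= n)%nat -> (0 < k)%nat ->
    ((m = d * k)%nat -> (n < m + k - 1)%nat ->
       exists lambda : R -> C, Ito_root_path n 1 k d (m - 1) lambda)
    /\
    ((m - 1 = d * k)%nat -> (n < m + k - 1)%nat ->
       exists lambda : R -> C, Ito_root_path n 1 k d m lambda).
Proof.
  intros d m n k Hd Hdm Hmn Hk.
  assert (Dd : 2 <= INR d) by (apply (le_INR 2), Hd).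
  split; intros Hm Hn.
  - assert (Hk2 : (2 <= k)%nat) by lia.
    assert (Dk : 2 <= INR k) by (apply (le_INR 2), Hk2).
    assert (Hdiv : (n / k = d)%nat).
    { symmetry. apply (Nat.div_unique n k d (n - m)); nia. }
    set (p := (m - 1)%nat).
    assert (HSp : S p = (d * k)%nat) by (unfold p; lia).
    assert (Hp : (3 <= p)%nat) by (unfold p; nia).
    assert (Ep : INR (S p) = INR d * INR k) by (rewrite HSp; apply mult_INR).
    assert (Ep' : INR p = INR d * INR k - 1) by (rewrite S_INR in Ep; lra).
    destruct (sector_ends p Hp) as [Hlt _].
    destruct (trinomial_root_path p Hp) as [r [t [Hr [Ht [Hr0 [Ht0 [Hr1 [Ht1 Hu]]]]]]]].
    assert (Hprod : 4 <= INR d * INR k) by nra.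
    assert (Hlt' : 1 / INR k < INR d / INR p).
    { rewrite Ep'. apply (Rmult_lt_reg_r (INR k * (INR d * INR k - 1))); [nra |].
      field_simplify; nra. }
    assert (Hlt1 : INR d / INR p < 1).
    { rewrite Ep'. apply (Rmult_lt_reg_r (INR d * INR k - 1)); [lra |].
      field_simplify; nra. }
    apply (Ito_root_path_polar n k d p d r t); try assumption.
    + lra.
    + lra.
    + rewrite Ht0, Ep. field. lra.
    + rewrite Ht1. field. lra.
    + rewrite Rmax_right; lra.
    + rewrite Rmin_left by lra. apply Rdiv_le_0_compat; lra.
    + intros a Ha. destruct (Hu a Ha) as [Hpos [Hsec Heq]].
      split; [exact Hpos |]. split.
      { rewrite Ht0, Ht1, Rmin_left, Rmax_right by lra. exact Hsec. }
      set (u := polar (r a) (t a)) in *.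
      unfold Ito_poly. rewrite Hdiv, <- !Cpow_mult_r.
      rewrite HSp in Heq. rewrite Heq.
      replace (a * u + (1 - a) - (1 - a))%C with (a * u)%C by ring.
      rewrite Cpow_mult_l.
      (* Since [d k = p + 1], the subtracted term has [u^(d p) u^d], matching the factor [u^(d p)]
         from [t^s] times [(a u)^d]. *)
      replace (d * (k * d))%nat with (d * p + d)%nat by nia.
      rewrite Cpow_add_r. ring.
  - assert (Hk2 : (2 <= k)%nat) by lia.
    assert (Dk : 2 <= INR k) by (apply (le_INR 2), Hk2).
    assert (Hdiv : (n / k = d)%nat).
    { symmetry. apply (Nat.div_unique n k d (n - (m - 1))); nia. }
    set (p := (m - 1)%nat) in *.
    assert (HSp : m = S p) by (unfold p; lia).
    assert (Hp : (3 <= p)%nat) by nia.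
    assert (Ep : INR p = INR d * INR k) by (rewrite Hm; apply mult_INR).
    assert (Ep' : INR (S p) = INR d * INR k + 1) by (rewrite S_INR; lra).
    destruct (sector_ends p Hp) as [Hlt _].
    destruct (trinomial_root_path p Hp) as [r [t [Hr [Ht [Hr0 [Ht0 [Hr1 [Ht1 Hu]]]]]]]].
    assert (Hprod : 4 <= INR d * INR k) by nra.
    assert (Hlt' : INR d / INR m < 1 / INR k).
    { rewrite HSp, Ep'. apply (Rmult_lt_reg_r (INR k * (INR d * INR k + 1))); [nra |].
      field_simplify; nra. }
    assert (Hlt1 : 1 / INR k < 1).
    { apply (Rmult_lt_reg_r (INR k)); [lra |]. field_simplify; lra. }
    assert (Hrev : forall f : R -> R, continuous_on (fun a => 0 <= a <= 1) f ->
      continuous_on (fun a => 0 <= a <= 1) (fun a => f (1 - a))).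
    { intros f Hf. apply (continuous_on_comp _ (fun a => 0 <= a <= 1) (fun a => 1 - a) f);
        [intros a Ha; lra | | exact Hf].
      apply continuous_on_forall. intros x _.
      apply (ex_derive_continuous (V := R_NormedModule)). auto_derive. trivial. }
    (* Here [d k = p], so the end [2 PI / p] of the trinomial path yields [2 PI / k], the required
       start; hence the reversal. *)
    apply (Ito_root_path_polar n k d m d (fun a => r (1 - a)) (fun a => t (1 - a)));
      rewrite ?Rminus_0_r, ?Rminus_diag; try assumption; try (apply Hrev; assumption).
    + lra.
    + rewrite HSp. lra.
    + rewrite Ht1, Ep. field. lra.
    + rewrite Ht0, HSp. field. lra.
    + rewrite Rmax_left; lra.
    + rewrite Rmin_right by lra. rewrite HSp. apply Rdiv_le_0_compat; lra.
    + intros a Ha. destruct (Hu (1 - a) ltac:(lra)) as [Hpos [Hsec Heq]].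
      split; [exact Hpos |]. split.
      { rewrite Ht0, Ht1, Rmin_right, Rmax_left by lra. exact Hsec. }
      set (u := polar (r (1 - a)) (t (1 - a))) in *.
      unfold Ito_poly. rewrite Hdiv, <- !Cpow_mult_r, <- Hm.
      (* As [m = p + 1], the extra [u^d] joins the bracket to form the [d]-th power of
         [u (u^p - (1 - a))], which the reversed trinomial equates to [a]. *)
      replace (d * m)%nat with (d * p + d)%nat by nia.
      replace (d * (k * d))%nat with (d * p)%nat by nia.
      rewrite Cpow_add_r, <- Cmult_assoc, <- Cpow_mult_l.
      replace (u * (u ^ p - (1 - a)))%C with (RtoC a); [ring |].
      rewrite Cpow_S, RtoC_minus in Heq.
      replace (u * (u ^ p - (1 - a)))%C with (u * u ^ p - (1 - a) * u)%C by ring.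
      rewrite Heq. ring.
Qed.
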